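(* Let $m,n$ be positive integers and let $f$ be a probability density function on $\mathbb R$. Let $N_1$ be a random variable with density $f$, and for each $k\ge 0$ let $S_k$ be the sum of $k$ independent random variables each taking the values $\pm1$ with equal probability, with $S_k$ also independent of $N_1$. Then for any function $q$, $$C(m,n,f)\;\ge\; n-m\,\mathbb E\big(q(N_1)\big)-\log_2\left(\sum_{k=0}^{n}\binom nk\left(\mathbb E\left(2^{-q\left(N_1-\frac{2S_k}{\sqrt m}\right)}\right)\right)^m\right).$$
   Context: Let $\mathcal M_{m\times n}(\pm1)$ be the set of $m\times n$ matrices with entries in $\{+1,-1\}$. For $A\in\mathcal M_{m\times n}(\pm1)$ and a pdf $f$ on $\mathbb R$, the noisy binary CDMA channel has input $X=(X_1,\dots,X_n)^T\in\{\pm1\}^n$ and output $Y=\frac1{\sqrt m}AX+N$, where $N=(N_1,\dots,N_m)^T$ is an additive noise vector with i.i.d. entries with density $f$, independent of $X$. Its sum capacity is $C(A,f)=\max I(X;Y)$, where $I$ is mutual information in bits (base-2 logarithms) and the maximum is over all product distributions of $X$ on $\{\pm1\}^n$ (i.e. $X_1,\dots,X_n$ independent). Define $C(m,n,f)=\max_{A\in\mathcal M_{m\times n}(\pm1)}C(A,f)$. *)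

(* Defs.v *)
From HB Require Import structures.
From mathcomp Require Import all_boot all_order all_algebra.
From mathcomp Require Import all_classical all_reals all_analysis.
From mathcomp Require Import measurable_realfun.

Set Implicit Arguments.
Unset Strict Implicit.
Unset Printing Implicit Defensive.

Import Order.TTheory GRing.Theory Num.Theory.
Import numFieldNormedType.Exports.

Local Open Scope classical_set_scope.
Local Open Scope ring_scope.

(* log2e 0 = -oo and log2e +oo = +oo *)
Definition log2e (R : realType) (x : \bar R) : \bar R :=
  (lne x * (ln 2)^-1%:E)%E.

Definition is_pdf (R : realType) (f : R -> R) : Prop :=
  [/\ measurable_fun [set: R] f,
      (forall x, 0 <= f x) &
      (\int[@lebesgue_measure R]_x (f x)%:E = 1)%E].

Definition has_density d (T : measurableType d) (R : realType)
    (P : probability T R) (Z : {RV P >-> R}) (f : R -> R) : Prop :=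
  forall B : set R, measurable B ->
    (P (Z @^-1` B) = \int[@lebesgue_measure R]_(x in B) (f x)%:E)%E.

Definition independent2 d d1 d2 (T : measurableType d) (T1 : measurableType d1)
    (T2 : measurableType d2) (R : realType) (P : probability T R)
    (X : {RV P >-> T1}) (Y : {RV P >-> T2}) : Prop :=
  forall (A : set T1) (B : set T2), measurable A -> measurable B ->
    (P (X @^-1` A `&` Y @^-1` B) = P (X @^-1` A) * P (Y @^-1` B))%E.

(* Taking B i = setT outside a subset of indices gives the product rule for
   every subfamily. *)
Definition mutually_independent d d1 (T : measurableType d)
    (T1 : measurableType d1) (R : realType) (P : probability T R) (k : nat)
    (Z : 'I_k -> {RV P >-> T1}) : Prop :=
  forall B : 'I_k -> set T1, (forall i, measurable (B i)) ->
    (P (\bigcap_(i in [set: 'I_k]) (Z i @^-1` B i)) =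
     \prod_(i < k) P (Z i @^-1` B i))%E.

Section vector_of_random_variables.
Context d (T : measurableType d) (R : realType) (P : probability T R).

Definition tupleRV (k : nat) (Z : 'I_k -> {RV P >-> R}) (t : T) : k.-tuple R :=
  [tuple Z i t | i < k].

Lemma measurable_tupleRV k (Z : 'I_k -> {RV P >-> R}) :
  measurable_fun [set: T] (tupleRV Z).
Proof.
apply/measurable_fun_tnthP => i.
rewrite (_ : _ \o _ = Z i); first exact: measurable_funPT.
by apply/funext => t /=; rewrite tnth_mktuple.
Qed.

HB.instance Definition _ k (Z : 'I_k -> {RV P >-> R}) :=
  isMeasurableFun.Build _ _ _ _ (tupleRV Z) (measurable_tupleRV Z).

End vector_of_random_variables.

Section joint_random_variable.
Context d d1 d2 (T : measurableType d) (T1 : measurableType d1)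
  (T2 : measurableType d2) (R : realType) (P : probability T R).

Definition pairRV (X : {RV P >-> T1}) (Y : {RV P >-> T2}) (t : T) : T1 * T2 :=
  (X t, Y t).

Lemma measurable_pairRV (X : {RV P >-> T1}) (Y : {RV P >-> T2}) :
  measurable_fun [set: T] (pairRV X Y).
Proof. by apply: measurable_fun_pair; exact: measurable_funPT. Qed.

HB.instance Definition _ (X : {RV P >-> T1}) (Y : {RV P >-> T2}) :=
  isMeasurableFun.Build _ _ _ _ (pairRV X Y) (measurable_pairRV X Y).

End joint_random_variable.

(* Relative entropy D(mu || nu) in bits. *)
Definition relative_entropy d (T : measurableType d) (R : realType)
    (mu nu : probability T R) : \bar R :=
  if `[< mu `<< nu >] then
    (\int[mu]_x log2e (Radon_Nikodym (charge_of_finite_measure mu) nu x))%E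
  else +oo%E.

(* I(X;Y) = D(P_(X,Y) || P_X (x) P_Y), meaningful for arbitrary X and Y; for a
   discrete X and a Y with conditional densities it is h(Y) - h(Y|X) whenever
   the latter difference makes sense. *)
Definition mutual_information d d1 d2 (T : measurableType d)
    (T1 : measurableType d1) (T2 : measurableType d2) (R : realType)
    (P : probability T R) (X : {RV P >-> T1}) (Y : {RV P >-> T2}) : \bar R :=
  relative_entropy (distribution P (pairRV X Y))
                   (distribution P X \x distribution P Y)%E.

Section cdma.
Context d (T : measurableType d) (R : realType) (P : probability T R).

Definition cdma_output (m n : nat) (A : 'M[R]_(m, n))
    (X : 'I_n -> {RV P >-> R}) (N : 'I_m -> {RV P >-> R}) (i : 'I_m) (t : T)
    : R :=
  ((Num.sqrt m%:R)^-1 *: (A *m \col_j X j t) + \col_k N k t) i 0.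

Lemma measurable_cdma_output m n (A : 'M[R]_(m, n))
    (X : 'I_n -> {RV P >-> R}) (N : 'I_m -> {RV P >-> R}) (i : 'I_m) :
  measurable_fun [set: T] (cdma_output A X N i).
Proof.
rewrite (_ : cdma_output A X N i = fun t =>
    (Num.sqrt m%:R)^-1 * (\sum_j A i j * X j t) + N i t); last first.
  apply/funext => t; rewrite /cdma_output !mxE; congr (_ * _ + _).
  by apply: eq_bigr => j _; rewrite mxE.
apply: measurable_funD; last exact: measurable_funPT.
apply: measurable_funM => //; apply: measurable_sum => j.
by apply: measurable_funM => //; exact: measurable_funPT.
Qed.

HB.instance Definition _ m n (A : 'M[R]_(m, n))
    (X : 'I_n -> {RV P >-> R}) (N : 'I_m -> {RV P >-> R}) (i : 'I_m) :=
  isMeasurableFun.Build _ _ _ _ (cdma_output A X N i)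
    (measurable_cdma_output A X N i).

(* Mutual independence of the X j is what makes the law of the input a product
   distribution on {1, -1}^n. *)
Definition cdma_input_noise (m n : nat) (f : R -> R)
    (X : 'I_n -> {RV P >-> R}) (N : 'I_m -> {RV P >-> R}) : Prop :=
  [/\ (forall j t, X j t = 1 \/ X j t = -1),
      mutually_independent X,
      (forall i, has_density (N i) f),
      mutually_independent N &
      independent2 (tupleRV X : {RV P >-> n.-tuple R})
                   (tupleRV N : {RV P >-> m.-tuple R})].

Definition is_rademacher_sum (k : nat) (S : {RV P >-> R}) : Prop :=
  exists eps : 'I_k -> {RV P >-> R},
    [/\ mutually_independent eps,
        (forall i, P (eps i @^-1` [set 1]) = (2^-1)%:E /\
                   P (eps i @^-1` [set -1]) = (2^-1)%:E) &
        (forall t, S t = \sum_(i < k) eps i t)].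

End cdma.

(* I(X;Y) depends only on the law of X once A and f are fixed, so quantifying
   over all probability spaces carrying the channel amounts to ranging over all
   product distributions of X. The maximum is taken as a supremum. *)
Definition sum_capacity_of (R : realType) (m n : nat) (A : 'M[R]_(m, n))
    (f : R -> R) : \bar R :=
  ereal_sup [set I | exists (d : measure_display) (T : measurableType d)
      (P : probability T R)
      (X : 'I_n -> {RV P >-> R}) (N : 'I_m -> {RV P >-> R}),
    cdma_input_noise f X N /\
    I = mutual_information
          (tupleRV X : {RV P >-> n.-tuple R})
          (tupleRV (fun i => cdma_output A X N i : {RV P >-> R})
             : {RV P >-> m.-tuple R})].

Definition pm1_matrices (R : realType) (m n : nat) : set 'M[R]_(m, n) :=
  [set A | forall i j, A i j = 1 \/ A i j = -1].

Definition sum_capacity (R : realType) (m n : nat) (f : R -> R) : \bar R :=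
  ereal_sup [set sum_capacity_of A f | A in @pm1_matrices R m n].

(* Main.v *)
Require Import Defs.
From HB Require Import structures.
From mathcomp Require Import all_boot all_order all_algebra.
From mathcomp Require Import ring lra.

Set Implicit Arguments.
Unset Strict Implicit.
Unset Printing Implicit Defensive.

Import Order.TTheory GRing.Theory Num.Theory.

Local Open Scope ring_scope.

(* Take a uniform input X and apply the Donsker-Varadhan bound
   I(X;Y) >= E g(X,Y) - log2 E 2^g(X,Y'), where Y' is an output independent of
   X, to g(x,y) = - sum_i q(y_i - (A x)_i / sqrt m).  Since g(X,Y) is
   - sum_i q(N_i), the first term is - m E q(N_1) for every A.  The second mean
   equals 4^-n sum_(x,x') prod_i psi((A (x' - x))_i) with
   psi(v) = E 2^(-q(N_1 + v / sqrt m)).  If x and x' differ in k places, then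
   (A (x' - x))_i is distributed as - 2 S_k for a uniform sign matrix A, so the
   average over A of this mean is 2^-n sum_k C(n,k) (E psi(- 2 S_k))^m, and some
   A does at least as well as the average.  When E q(N_1) or the sum over k is
   infinite, the left-hand side is -oo: finiteness of the k = 0 term bounds the
   negative part of q(N_1). *)

(** * Sums over sign vectors *)

(* A vector of signs is encoded by the set of its entries equal to -1. *)
Definition sgn (R : pzRingType) (I : finType) (u : {set I}) (i : I) : R :=
  (-1) ^+ (i \in u).

(** In the encoding by sets, this is the entrywise product of two sign vectors. *)
Definition symdiff (I : finType) (u v : {set I}) : {set I} :=
  [set i | (i \in u) (+) (i \in v)].

Lemma symdiffK (I : finType) (v : {set I}) : involutive (fun u => symdiff u v).
Proof. by move=> u; apply/setP => i; rewrite !inE -addbA addbb addbF. Qed.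

Lemma sgn_symdiff (R : pzRingType) (I : finType) (u v : {set I}) i :
  sgn R (symdiff u v) i = sgn R u i * sgn R v i.
Proof. by rewrite /sgn inE signr_addb. Qed.

Lemma sgnE (R : pzRingType) (I : finType) (u : {set I}) i :
  sgn R u i = 1 - (i \in u)%:R *+ 2.
Proof.
rewrite /sgn; case: (i \in u); rewrite /= ?mul0rn ?subr0 //.
by rewrite expr1 mulr2n opprD addrA subrr add0r.
Qed.

Lemma sgn_mul_self (R : pzRingType) (I : finType) (u : {set I}) i :
  sgn R u i * sgn R u i = 1.
Proof. by rewrite /sgn -signr_addb addbb. Qed.

Lemma sum_sgn (R : pzRingType) (I : finType) (r D : {set I}) :
  \sum_(i in D) sgn R r i = #|D|%:R - #|r :&: D|%:R *+ 2.
Proof.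
under eq_bigr do rewrite sgnE.
rewrite big_split /= sumr_const; congr (_ + _).
rewrite sumrN sumrMnl -natr_sum; congr (- (_%:R *+ _)).
rewrite -big_mkcondr /= sum1dep_card; apply: eq_card => i.
by rewrite !inE andbC.
Qed.

Lemma sum_card_subset (V : nmodType) (I : finType) (D : {set I})
    (H : nat -> V) :
  \sum_(u : {set I} | u \subset D) H #|u| =
  \sum_(k < #|D|.+1) H k *+ 'C(#|D|, k).
Proof.
(* [inord] does not truncate here, since [#|u| <= #|D|] for [u] inside [D]. *)
rewrite (partition_big (fun u : {set I} => inord #|u| : 'I_#|D|.+1) xpredT) //=.
apply: eq_bigr => k _.
rewrite (eq_bigl [in [set u : {set I} | u \subset D & #|u| == k]]); last first.
  move=> u; rewrite inE; apply: andb_id2l => uD.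
  by rewrite -val_eqE /= inordK // ltnS subset_leq_card.
rewrite (eq_bigr (fun=> H k)) => [|u]; last by rewrite inE => /andP[_ /eqP ->].
by rewrite sumr_const cards_draws.
Qed.

(** Each [u] inside [D] is the trace on [D] of exactly [2 ^ #|~: D|] sets, namely [u :|: B] with [B]
    inside the complement of [D]. *)
Lemma sum_setI (V : nmodType) (I : finType) (D : {set I}) (F : {set I} -> V) :
  \sum_(r : {set I}) F (r :&: D) =
  \sum_(u : {set I} | u \subset D) F u *+ 2 ^ #|~: D|.
Proof.
rewrite (partition_big (fun r => r :&: D) (fun u => u \subset D)) /=;
  last first.
  by move=> r _; exact: subsetIr.
apply: eq_bigr => u uD; rewrite (eq_bigr (fun=> F u)) => [|r /eqP -> //].
rewrite -card_powerset sumr_const; congr (_ *+ _).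
have injU : {in powerset (~: D) &, injective (fun B => u :|: B)}.
  move=> B C; rewrite !inE => /subsetP BD /subsetP CD /setP BC; apply/setP => i.
  have := BC i; rewrite !inE; have [iu|] //= := boolP (i \in u).
  have iD := subsetP uD _ iu.
  have /negP/negPf -> : ~ i \in B by move=> /BD; rewrite inE iD.
  by have /negP/negPf -> : ~ i \in C by move=> /CD; rewrite inE iD.
rewrite -(card_in_imset injU); apply: eq_card => r;
  rewrite -[LHS]/(r :&: D == u).
apply/idP/imsetP => [/eqP ru|[B]].
  exists (r :\: D); first by rewrite inE subDset setUCr subsetT.
  by rewrite -ru setID.
rewrite inE => BD ->; rewrite setIUl (setIidPl uD).
by move: BD; rewrite subsets_disjoint setCK => /disjoint_setI0 ->;
  rewrite setU0.
Qed.

(** Both inner sums depend only on the number of entries -1 among the [#|D|] relevant ones, so both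
    sides reduce to the same binomial sum. The entries of [r] outside [D] are free and give the
    factor. *)
Lemma sum_sum_sgn (R : pzRingType) (V : nmodType) (I : finType) (D : {set I})
    (h : R -> V) :
  \sum_(r : {set I}) h (\sum_(i in D) sgn R r i) =
  (\sum_(u : {set 'I_#|D|}) h (\sum_i sgn R u i)) *+ 2 ^ #|~: D|.
Proof.
pose H k := h (#|D|%:R - k%:R *+ 2).
rewrite (eq_bigr (fun r : {set I} => H #|r :&: D|)); last first.
  by move=> r _; rewrite sum_sgn.
rewrite (sum_setI D (fun u => H #|u|)) sumrMnl; congr (_ *+ _).
rewrite (eq_bigr (fun u : {set 'I_#|D|} => H #|u|)); last first.
  move=> u _; have := sum_sgn R u [set: 'I_#|D|].
  rewrite cardsT card_ord setIT /H => <-.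
  by congr h; apply: eq_bigl => i; rewrite inE.
rewrite sum_card_subset; have := sum_card_subset [set: 'I_#|D|] H.
rewrite cardsT card_ord => <-.
by apply: eq_bigl => u; rewrite subsetT.
Qed.


Lemma card_set_type (I : finType) : #|{set I}| = (2 ^ #|I|)%N.
Proof. by rewrite -[in RHS]cardsT -card_powerset powersetT cardsT. Qed.

Lemma exists_le_mean (R : realFieldType) (I : finType) (F : I -> R) (c : R) :
  (0 < #|I|)%N -> \sum_i F i <= #|I|%:R * c -> exists i, F i <= c.
Proof.
move=> I0 Fc; apply/existsP; move: Fc; apply: contraLR.
rewrite negb_exists -ltNge => /forallP ltF.
rewrite mulr_natl -sumr_const; apply: ltr_sum => [|i _]; last by rewrite ltNge.
by have /card_gt0P[i0 _] := I0; apply/hasP; exists i0; rewrite ?mem_index_enum.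
Qed.

(** Multiplying [r] by [s] permutes the sign vectors and eliminates [s]: the summand becomes
    [r_j (u_j - 1)], which is [-2 r_j] for [j] in [u] and 0 elsewhere. *)
Lemma sum_sgn_diff (R : comPzRingType) (V : nmodType) (I : finType)
    (s u : {set I}) (psi : R -> V) :
  \sum_(r : {set I})
    psi (\sum_j sgn R r j * (sgn R (symdiff u s) j - sgn R s j)) =
  (\sum_(w : {set 'I_#|u|}) psi (- 2 * \sum_i sgn R w i)) *+ 2 ^ #|~: u|.
Proof.
rewrite (reindex_inj (inv_inj (symdiffK s))) /=.
rewrite (eq_bigr (fun r => psi (- 2 * \sum_(j in u) sgn R r j))); last first.
  move=> r _; congr psi; rewrite mulr_sumr [RHS]big_mkcond /=.
  apply: eq_bigr => j _; rewrite !sgn_symdiff mulrBr.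
  rewrite mulrACA -!mulrA sgn_mul_self !mulr1.
  by rewrite (sgnE R u j); case: (j \in u) => /=; ring.
exact: (sum_sum_sgn u (fun x => psi (- 2 * x))).
Qed.

(** * Averaging over all sign matrices *)

Section random_matrix.
Variables (R : realFieldType) (m n : nat) (psi : R -> R).

(** The mean of [psi (- 2 S_k)], where [S_k] is a sum of [k] independent uniform signs. *)
Let M k := (2 ^+ k)^-1 * \sum_(u : {set 'I_k}) psi (- 2 * \sum_i sgn R u i).

Let sum_row (s u : {set 'I_n}) :
  \sum_(r : {set 'I_n})
    psi (\sum_j sgn R r j * (sgn R (symdiff u s) j - sgn R s j)) =
  2 ^+ n * M #|u|.
Proof.
rewrite sum_sgn_diff /M mulrA.
have -> : 2 ^+ n = 2 ^+ #|u| * 2 ^+ #|~: u| :> R.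
  by rewrite -exprD cardsC card_ord.
rewrite [2 ^+ #|u| * _]mulrC mulfK ?expf_neq0 ?pnatr_eq0 //.
by rewrite -[LHS]mulr_natl natrX.
Qed.

(** Probabilistic method: the right-hand side is exactly the mean of the left-hand side over all
    [B]. The rows of [B] range independently, so the sum over [B] of the product over rows is the
    [m]-th power of a single row sum. *)
Lemma exists_sign_matrix : exists B : {ffun 'I_m -> {set 'I_n}},
  (2 ^+ n * 2 ^+ n)^-1 * (\sum_(s : {set 'I_n}) \sum_(s' : {set 'I_n})
     \prod_(i < m) psi (\sum_j sgn R (B i) j * (sgn R s' j - sgn R s j))) <=
  (2 ^+ n)^-1 * \sum_(k < n.+1) 'C(n, k)%:R * M k ^+ m.
Proof.
apply: exists_le_mean;
  first by rewrite card_ffun expn_gt0 card_set_type expn_gt0.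
rewrite le_eqVlt; apply/orP; left; apply/eqP.
rewrite -mulr_sumr exchange_big /=.
have sumB s : \sum_(B : {ffun 'I_m -> {set 'I_n}}) \sum_(s' : {set 'I_n})
     \prod_(i < m) psi (\sum_j sgn R (B i) j * (sgn R s' j - sgn R s j)) =
   (2 ^+ n) ^+ m * \sum_(k < n.+1) 'C(n, k)%:R * M k ^+ m.
  (* Here [s'] is written as the product of [s] with a sign vector [u], which marks the places where
     the two differ; only [#|u|] then matters. *)
  rewrite exchange_big /= (reindex_inj (inv_inj (symdiffK s))) /=.
  have sumM := sum_card_subset [set: 'I_n] (fun k => (2 ^+ n * M k) ^+ m).
  rewrite cardsT card_ord (eq_bigl xpredT) in sumM; last first.
    by move=> u; rewrite subsetT.
  transitivity (\sum_(u : {set 'I_n}) (2 ^+ n * M #|u|) ^+ m).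
    apply: eq_bigr => u _.
    rewrite -(bigA_distr_bigA (fun _ r => psi (\sum_j sgn R r j *
      (sgn R (symdiff u s) j - sgn R s j)))) /=.
    by under eq_bigr do rewrite sum_row; rewrite prodr_const card_ord.
  rewrite {}sumM mulr_sumr; apply: eq_bigr => k _.
  by rewrite -[LHS]mulr_natl exprMn mulrCA.
rewrite (eq_bigr _ (fun s _ => sumB s)) sumr_const card_set_type card_ord.
rewrite card_ffun card_set_type !card_ord !natrX -[_ *+ 2 ^ n]mulr_natl natrX.
by field; rewrite expf_neq0 ?pnatr_eq0.
Qed.

End random_matrix.

From mathcomp Require Import all_classical all_reals all_analysis.
From mathcomp Require Import measurable_realfun.

Import numFieldNormedType.Exports.

Local Open Scope classical_set_scope.
Local Open Scope ring_scope.

(** * A lower bound on relative entropy *)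

Section integral_comparison.
Local Open Scope ereal_scope.
Context d (T : measurableType d) (R : realType).
Variable mu : {measure set T -> \bar R}.

(** The order passes to positive parts and is reversed on negative parts, which reduces the claim to
    nonnegative functions. The integrals may be infinite, as a relative entropy can be. *)
Lemma ae_le_integral (D : set T) (f1 f2 : T -> \bar R) :
  measurable D -> measurable_fun D f1 -> measurable_fun D f2 ->
  {ae mu, forall x, D x -> f1 x <= f2 x} ->
  \int[mu]_(x in D) f1 x <= \int[mu]_(x in D) f2 x.
Proof.
move=> mD mf1 mf2 f12; rewrite integralE [leRHS]integralE leeB//.
- apply: ae_ge0_le_integral => //; [exact: measurable_funepos..|].
  apply: filterS f12 => x f12 Dx.
  by rewrite !funeposE ge_max le_max f12//= le_max lexx orbT.
- apply: ae_ge0_le_integral => //; [exact: measurable_funeneg..|].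
  apply: filterS f12 => x f12 Dx.
  by rewrite !funenegE ge_max le_max leeN2 f12//= le_max lexx orbT.
Qed.

End integral_comparison.

(** A zero integral would force [f = 0] almost everywhere, and then the whole space would be a null
    set. *)
Lemma integral_gt0 d (T : measurableType d) (R : realType)
    (P : probability T R) (f : T -> R) :
  measurable_fun [set: T] f -> (forall x, 0 < f x) ->
  (0 < \int[P]_x (f x)%:E)%E.
Proof.
move=> mf f0; rewrite lt0e integral_ge0 ?andbT; last first.
  by move=> x _; rewrite lee_fin ltW.
apply/eqP => If0.
have /ae_eq_integral_abs : (\int[P]_x `|(f x)%:E| = 0)%E.
  rewrite -[RHS]If0; apply: eq_integral => x _.
  by rewrite gee0_abs// lee_fin ltW.
move=> /(_ measurableT); case.
  exact/measurable_EFinP.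
move=> N [mN PN0 sub].
have : (P [set: T] <= P N)%E.
  rewrite le_measure ?inE// => x _; apply: sub => /= /(_ Logic.I) [].
  by apply/eqP; rewrite gt_eqF.
by rewrite probability_setT PN0 lee_fin ler10.
Qed.

Lemma ln2_gt0 (R : realType) : 0 < ln 2 :> R.
Proof. by rewrite ln_gt0// ltr1n. Qed.

Lemma measurable_log2e (R : realType) :
  measurable_fun [set: R] (fun r : R => log2e r%:E).
Proof.
rewrite (_ : (fun r => _) =
    fun r : R => if (r <= 0)%R then -oo%E else (ln r / ln 2)%:E); last first.
  apply/funext => r; rewrite /log2e /=; case: ifPn => // _.
  by rewrite gt0_mulNye// lte_fin invr_gt0 ln2_gt0.
apply: measurable_fun_ifT => //.
- exact: measurable_fun_ler.
- apply/measurable_EFinP; apply: measurable_funM => //; exact: measurable_ln.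
Qed.

Lemma log2e_EFin (R : realType) (x : R) :
  0 < x -> log2e x%:E = (ln x / ln 2)%:E.
Proof. by move=> x0; rewrite /log2e lne_EFin. Qed.

(** If [mu] is not dominated by [nu], the relative entropy is +oo. Otherwise let [h] be the density
    and [Z] the [nu]-mean of [2^g]. The quotient [v = 2^g / (Z h)] has [mu]-mean at most 1, and
    integrating [ln v <= v - 1] against [mu] gives the bound. *)
Lemma donsker_varadhan d (T : measurableType d) (R : realType)
    (mu nu : probability T R) (g : T -> R) :
  measurable_fun [set: T] g -> mu.-integrable [set: T] (EFin \o g) ->
  (\int[nu]_x (2 `^ g x)%:E < +oo)%E ->
  (\int[mu]_x (g x)%:E - log2e (\int[nu]_x (2 `^ g x)%:E)
   <= relative_entropy mu nu)%E.
Proof.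
move=> mg ig eg; rewrite /relative_entropy; case: ifPn => [/asboolP munu|_];
  last by rewrite leey.
have m2g : measurable_fun [set: T] (fun x => 2 `^ g x).
  exact: measurableT_comp (measurable_powRr _) mg.
have Z0 := integral_gt0 nu m2g (fun x => powR_gt0 (g x) (ltr0n R 2)).
set I := (\int[nu]_x _)%E in eg Z0 *.
pose Z := fine I.
have IZ : I = Z%:E by rewrite fineK// ge0_fin_numE// ltW.
rewrite IZ in Z0 *; rewrite lte_fin in Z0.
rewrite log2e_EFin//.
(* This version of the density is nonnegative and finite at every point; it is identified with
   [Radon_Nikodym] almost everywhere at the end. *)
pose h := Radon_Nikodym_SigmaFinite.f mu nu.
have h0 : forall x, (0 <= h x)%E := Radon_Nikodym_SigmaFinite.f_ge0 munu.
have hfin : forall x, h x \is a fin_num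
  := Radon_Nikodym_SigmaFinite.f_fin_num munu.
have mh : measurable_fun [set: T] h.
  exact: measurable_int (Radon_Nikodym_SigmaFinite.f_integrable munu).
pose k x := fine (h x).
have hk x : h x = (k x)%:E by rewrite fineK.
have mk : measurable_fun [set: T] k by exact: measurableT_comp.
have k0 x : 0 <= k x by rewrite fine_ge0.
have ln20 : 0 < ln 2 :> R := ln2_gt0 R.
(* Division by zero makes [v x = 0] where [k x = 0], so that [k x * v x <= 2^(g x) / Z] holds
   everywhere, possibly strictly. *)
pose v x := 2 `^ g x / Z / k x.
have v0 x : 0 <= v x by rewrite !divr_ge0// ?powR_ge0// ltW.
have mv : measurable_fun [set: T] v.
  apply: measurable_funM; first by apply: measurable_funM.
  under eq_fun do rewrite -powR_inv1//.
  exact: (measurableT_comp (measurable_powR (-1)) mk).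
have iv : (\int[mu]_x (v x)%:E <= 1)%E.
  rewrite -(@Radon_Nikodym_SigmaFinite.change_of_variables _ _ _ _ nu)//;
    first last.
  - exact/measurable_EFinP.
  apply: (@le_trans _ _ (\int[nu]_x ((Z^-1)%:E * (2 `^ g x)%:E))%E).
    apply: ge0_le_integral => //.
    + by move=> x _; rewrite mule_ge0// lee_fin.
    + by apply: emeasurable_funM => //; exact/measurable_EFinP.
    + apply: emeasurable_funM => //; exact/measurable_EFinP.
    + move=> x _; rewrite -/(h x) hk -!EFinM lee_fin /v.
      have [->|kx] := eqVneq (k x) 0; last by rewrite divfK// mulrC.
      by rewrite mulr0 mulr_ge0 ?invr_ge0 ?powR_ge0// ltW.
  rewrite ge0_integralZl//; last 2 first.
  - exact/measurable_EFinP.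
  - by rewrite lee_fin invr_ge0 ltW.
  by rewrite -/I IZ -EFinM mulVf// gt_eqF.
(* [ln v <= v - 1] gives [phi <= log2 k] where [k != 0], and phi has the right
   mean because [v] integrates to at most 1. *)
pose phi x := g x - ln Z / ln 2 + (1 - v x) / ln 2.
have iv1 : mu.-integrable [set: T] (EFin \o v).
  apply/integrableP; split; first exact/measurable_EFinP.
  apply: le_lt_trans (ltry 1); apply: le_trans iv.
  by under eq_integral do rewrite gee0_abs ?lee_fin//.
have icst (c : R) : mu.-integrable [set: T] (EFin \o cst c).
  exact: finite_measure_integrable_cst.
have Icst (c : R) : (\int[mu]_x c%:E = c%:E)%E.
  rewrite [LHS](integral_cst mu measurableT c%:E).
  by rewrite [X in (_ * X)%E]probability_setT mule1.
have phiE : (\int[mu]_x (phi x)%:E =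
    \int[mu]_x (g x)%:E - (ln Z / ln 2)%:E + (ln 2)^-1%:E
    - (ln 2)^-1%:E * \int[mu]_x (v x)%:E)%E.
  rewrite (eq_integral (fun x => ((g x)%:E - (ln Z / ln 2)%:E) + (ln 2)^-1%:E
    - (ln 2)^-1%:E * (v x)%:E)%E); last first.
    by move=> x _; rewrite -!EFinM -!EFinD /phi; congr _%:E; field;
      rewrite gt_eqF.
  have i1 : mu.-integrable [set: T] (fun x => (g x)%:E - (ln Z / ln 2)%:E)%E.
    exact: integrableB (icst _).
  have i2 : mu.-integrable [set: T]
      (fun x => (g x)%:E - (ln Z / ln 2)%:E + (ln 2)^-1%:E)%E.
    exact: integrableD (icst _).
  have i3 : mu.-integrable [set: T] (fun x => (ln 2)^-1%:E * (v x)%:E)%E.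
    exact: integrableZl.
  rewrite integralB// integralD//; last exact: icst.
  rewrite integralB//; last exact: icst.
  by rewrite integralZl// !Icst.
apply: (@le_trans _ _ (\int[mu]_x (phi x)%:E)%E).
  rewrite phiE.
  have gfin : (\int[mu]_x (g x)%:E)%E \is a fin_num.
    exact: integrable_fin_num ig.
  have vfin : (\int[mu]_x (v x)%:E)%E \is a fin_num.
    exact: integrable_fin_num iv1.
  move: iv; rewrite -(fineK gfin) -(fineK vfin).
  set V := fine _; set G := fine _.
  rewrite -EFinM -!EFinB !lee_fin => V1.
  rewrite -addrA lerDl subr_ge0.
  by rewrite ler_piMr// invr_ge0 ltW.
have mphi : measurable_fun [set: T] phi.
  apply: measurable_funD; first exact: measurable_funB.
  by apply: measurable_funM => //; exact: measurable_funB.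
apply: ae_le_integral => //.
- exact/measurable_EFinP.
- rewrite (_ : (fun x => _) = (fun x => log2e (fine (Radon_Nikodym
      (charge_of_finite_measure mu) nu x))%:E)).
    apply: (measurableT_comp (@measurable_log2e R)).
    apply: measurableT_comp => //.
  by apply/funext => x; rewrite fineK// Radon_Nikodym_fin_num.
(* The [mu]-measure of the zero set of [h] is the [nu]-integral of [h] over that set, hence 0. *)
have aeh : {ae mu, forall x, h x != 0}.
  exists (h @^-1` [set 0%E]); split.
  - by rewrite -[X in measurable X]setTI; exact: mh.
  - rewrite (Radon_Nikodym_SigmaFinite.f_integral munu); last first.
      by rewrite -[X in measurable X]setTI; exact: mh.
    by rewrite integral0_eq// => x /= ->.
  - by move=> x /= /negP; rewrite negbK => /eqP.
have aeRN : ae_eq mu [set: T] h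
    (Radon_Nikodym (charge_of_finite_measure mu) nu).
  apply: (null_dominates_ae_eq measurableT munu).
  exact: ae_eq_Radon_Nikodym_SigmaFinite.
apply: filterS2 aeh aeRN => x hx0 /(_ Logic.I) <- _.
have kx0 : 0 < k x.
  rewrite lt_neqAle k0 andbT eq_sym; apply: contra hx0 => /eqP kx0.
  by rewrite hk kx0.
rewrite hk log2e_EFin// lee_fin.
have vx0 : 0 < v x by rewrite !divr_gt0// powR_gt0.
have : ln (v x) <= v x - 1.
  by have := @le_ln1Dx R (v x - 1); rewrite addrCA subrr addr0; apply; lra.
rewrite /v !ln_div ?posrE ?divr_gt0 ?powR_gt0// ln_powR -/(v x) => lnv.
rewrite ler_pdivlMr// /phi mulrDl mulrBl !divfK ?gt_eqF//.
lra.
Qed.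

(** * Independence *)

Section independence.
Local Open Scope ereal_scope.
Context d d1 d2 (T : measurableType d) (T1 : measurableType d1)
  (T2 : measurableType d2) (R : realType) (P : probability T R).
Variables (X : {RV P >-> T1}) (Y : {RV P >-> T2}).

Lemma ge0_integral_product_distribution (G : T1 * T2 -> \bar R) :
  measurable_fun [set: T1 * T2] G -> (forall z, 0 <= G z) ->
  \int[distribution P X \x distribution P Y]_z G z =
  \int[P]_t \int[P]_t' G (X t, Y t').
Proof.
move=> mG G0; rewrite fubini_tonelli1// /fubini_F.
rewrite ge0_integral_distribution//; last 2 first.
- exact: measurable_fun_fubini_tonelli_F.
- by move=> x; exact: integral_ge0.
apply: eq_integral => t _ /=.
rewrite (@ge0_integral_distribution _ _ _ _ _ P Y (fun y => G (X t, y)))//.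
exact: (measurableT_comp mG (pair1_measurable (X t))).
Qed.

(** Independence says that the joint law and the product law agree on rectangles, and this
    determines a product measure. *)
Lemma ge0_integral_independent2 (G : T1 * T2 -> \bar R) :
  independent2 X Y ->
  measurable_fun [set: T1 * T2] G -> (forall z, 0 <= G z) ->
  \int[P]_t G (X t, Y t) = \int[P]_t \int[P]_t' G (X t, Y t').
Proof.
move=> XY mG G0; rewrite -ge0_integral_product_distribution//.
rewrite -[LHS](ge0_integral_distribution (pairRV X Y) mG G0).
apply: eq_measure_integral => A mA _; apply/esym.
exact: product_measure_unique.
Qed.

End independence.

(** * Independent copies and uniform signs *)

Definition mkRV d d' (T : measurableType d) (T' : measurableType d')
    (R : realType) (P : probability T R) (f : T -> T')
    (mf : measurable_fun [set: T] f) : {RV P >-> T'} :=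
  HB.pack f (isMeasurableFun.Build _ _ _ _ f mf).

Lemma measurable_prode d (T : measurableType d) (R : realType) (I : Type)
    (s : seq I) (h : I -> T -> \bar R) :
  (forall i, measurable_fun [set: T] (h i)) ->
  measurable_fun [set: T] (fun x => \prod_(i <- s) h i x)%E.
Proof.
move=> mh; elim: s => [|i s ih].
  under eq_fun do rewrite big_nil.
  exact: measurable_cst.
under eq_fun do rewrite big_cons.
exact: emeasurable_funM.
Qed.

(* Z is i.i.d. with law Q, expressed by test functions instead of events. *)
Definition product_law d d' (T : measurableType d) (T' : measurableType d')
    (R : realType) (P : probability T R) (Q : probability T' R) (k : nat)
    (Z : 'I_k -> {RV P >-> T'}) : Prop :=
  forall h : 'I_k -> T' -> \bar R,
    (forall i, measurable_fun [set: T'] (h i)) ->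
    (forall i x, 0 <= h i x)%E ->
    (\int[P]_t (\prod_(i < k) h i (Z i t)) = \prod_(i < k) \int[Q]_x h i x)%E.

(** Induction on [k]: the space is multiplied by one more factor of law [Q], whose coordinate
    becomes number 0 while the old ones are shifted, and Tonelli splits off the new factor. *)
Lemma exists_product_law d' (T' : measurableType d') (R : realType)
    (Q : probability T' R) (k : nat) :
  exists (d : measure_display) (T : measurableType d) (P : probability T R)
    (Z : 'I_k -> {RV P >-> T'}), product_law Q Z.
Proof.
elim: k => [|k [d [T [P [Z PZ]]]]].
  (* With no coordinates any probability space serves, so that of [Q] is taken. *)
  exists d', T', Q, (fun _ => mkRV Q (@measurable_id _ T' setT)) => h mh h0.
  rewrite big_ord0; under eq_integral do rewrite big_ord0.
  rewrite [LHS](integral_cst Q measurableT 1%E).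
  by rewrite [X in (_ * X)%E]probability_setT mule1.
pose mZ (i : 'I_k.+1) (t : T * T') :=
  if unlift ord0 i is Some j then Z j t.1 else t.2.
have mmZ i : measurable_fun setT (mZ i).
  rewrite /mZ; case: (unlift ord0 i) => [j|]; last exact: measurable_snd.
  exact: measurableT_comp measurable_fst.
exists _, (T * T')%type, (P \x Q)%E, (fun i => mkRV _ (mmZ i)) => h mh h0.
have Zl j t : mZ (lift ord0 j) t = Z j t.1 by rewrite /mZ liftK.
have Z0 t : mZ ord0 t = t.2 by rewrite /mZ unlift_none.
rewrite (eq_integral (fun t =>
    h ord0 t.2 * \prod_(i < k) h (lift ord0 i) (Z i t.1))%E); last first.
  move=> t _; rewrite big_ord_recl /= Z0; congr (_ * _)%E.
  by apply: eq_bigr => i _; rewrite Zl.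
have mprod :
    measurable_fun setT (fun t => \prod_(i < k) h (lift ord0 i) (Z i t))%E.
  by apply: measurable_prode => i; exact: measurableT_comp.
have prod0 t : (0 <= \prod_(i < k) h (lift ord0 i) (Z i t))%E.
  by apply: prode_ge0.
rewrite fubini_tonelli1//; last 2 first.
- apply: emeasurable_funM; first exact: measurableT_comp measurable_snd.
  exact: (measurableT_comp mprod measurable_fst).
- by move=> t; rewrite mule_ge0.
rewrite /fubini_F /=.
under eq_integral => t _ do rewrite ge0_integralZr//.
by rewrite ge0_integralZl ?big_ord_recl -?PZ// integral_ge0.
Qed.

Lemma sgn_inj (R : numDomainType) (I : finType) (u v : {set I}) :
  (forall i, sgn R u i = sgn R v i) -> u = v.
Proof.
move=> uv; apply/setP => i; have := uv i; rewrite !sgnE => /addrI /oppr_inj.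
by move=> /eqP; rewrite eqrMn2r// eqr_nat; case: (i \in u) (i \in v) => [] [].
Qed.

Lemma sgn_pm1 (R : pzRingType) (I : finType) (u : {set I}) i :
  sgn R u i = 1 \/ sgn R u i = -1.
Proof. by rewrite /sgn; case: (i \in u); rewrite ?expr1; [right|left]. Qed.

(** The variables are signs only almost surely. The [2 ^ k] events [E u] are disjoint and have
    probability [(2 ^+ k)^-1] each, so together they have full measure and the integral splits over
    them. *)
Lemma ge0_integral_signs d (T : measurableType d) (R : realType)
    (P : probability T R) (k : nat) (eps : 'I_k -> {RV P >-> R})
    (phi : k.-tuple R -> \bar R) :
  mutually_independent eps ->
  (forall i, P (eps i @^-1` [set 1]) = (2^-1)%:E /\
             P (eps i @^-1` [set -1]) = (2^-1)%:E) ->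
  measurable_fun [set: k.-tuple R] phi -> (forall x, 0 <= phi x)%E ->
  (\int[P]_t phi (tupleRV eps t) =
   \sum_(u : {set 'I_k}) ((2 ^+ k)^-1)%:E * phi [tuple sgn R u i | i < k])%E.
Proof.
move=> ieps half mphi phi0.
pose E (u : {set 'I_k}) :=
  \bigcap_(i in [set: 'I_k]) (eps i @^-1` [set sgn R u i]).
have mE u : measurable (E u).
  apply: fin_bigcap_measurable; first exact: finite_finset.
  by move=> i _; rewrite -[X in measurable X]setTI; exact: measurable_funPT.
have PE u : P (E u) = ((2 ^+ k)^-1)%:E.
  rewrite ieps; last by move=> i.
  rewrite (eq_bigr (fun=> (2^-1)%:E)); last first.
    by move=> i _; have [h1 hN1] := half i; have [->|->] := sgn_pm1 R u i.
  by rewrite prodEFin prodr_const card_ord exprVn.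
have tE : trivIset [set` index_enum {set 'I_k}] E.
  move=> u v _ _ [t [Eu Ev]]; apply: (@sgn_inj R) => i.
  by rewrite -(Eu i Logic.I) -(Ev i Logic.I).
have intE (f : T -> \bar R) := @ge0_integral_bigsetU _ _ _ P _ E f
  (index_enum {set 'I_k}) mE (index_enum_uniq _) tE.
set D := \big[setU/set0]_(u <- _) E u in intE.
have mD : measurable D by exact: bigsetU_measurable.
have mphiX : measurable_fun [set: T] (fun t => phi (tupleRV eps t)).
  exact: (measurableT_comp mphi (measurable_tupleRV eps)).
have Icst (A : set T) (c : \bar R) : measurable A ->
    (\int[P]_(x in A) cst c x = c * P A)%E.
  by move=> mA; exact: integral_cst.
have PD : P D = 1%E.
  have := intE (cst 1%E) (measurable_cst _) (fun x _ => lee01).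
  rewrite Icst// mul1e => ->.
  rewrite (eq_bigr (fun=> ((2 ^+ k)^-1)%:E)); last first.
    by move=> u _; rewrite Icst// mul1e PE.
  rewrite sumEFin sumr_const card_set_type card_ord.
  by rewrite -[_ *+ _]mulr_natr natrX mulVf// expf_neq0// pnatr_eq0.
rewrite (@ge0_negligible_integral _ _ _ P _ (~` D))//; last 2 first.
- exact: measurableC.
- by rewrite -[RHS](subee (x := 1%E))// -{2}PD; exact: probability_setC.
rewrite setTD setCK intE//; last exact: measurable_funTS.
apply: eq_bigr => u _.
rewrite (eq_integral (cst (phi [tuple sgn R u i | i < k]))); last first.
  move=> t /[!inE] Et; congr phi; apply: eq_from_tnth => i.
  by rewrite !tnth_mktuple; exact: (Et i Logic.I).
by rewrite Icst// muleC PE.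
Qed.

Section product_law.
Local Open Scope ereal_scope.
Context d d' (T : measurableType d) (T' : measurableType d') (R : realType)
  (P : probability T R) (Q : probability T' R) (k : nat)
  (Z : 'I_k -> {RV P >-> T'}).
Hypothesis QZ : product_law Q Z.

(** The indicators of the [B i] serve as test functions: their product is the indicator of the
    intersection. *)
Lemma product_law_bigcap (B : 'I_k -> set T') :
  (forall i, measurable (B i)) ->
  P (\bigcap_(i in [set: 'I_k]) (Z i @^-1` B i)) = \prod_(i < k) Q (B i).
Proof.
move=> mB; have mZB i : measurable (Z i @^-1` B i).
  by rewrite -[X in measurable X]setTI; exact: measurable_funPT.
rewrite (eq_bigr (fun i => \int[Q]_x (\1_(B i) x)%:E)); last first.
  by move=> i _; rewrite integral_indic// setIT.
rewrite -QZ; last 2 first.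
- by move=> i; exact/measurable_EFinP.
- by move=> i x; rewrite lee_fin.
transitivity (\int[P]_t (\1_(\bigcap_(i in [set: 'I_k]) (Z i @^-1` B i)) t)%:E).
  rewrite integral_indic ?setIT//.
  by apply: fin_bigcap_measurable => //; exact: finite_finset.
apply: eq_integral => t _; rewrite prodEFin indicE; congr _%:E.
have [/set_mem tB|tB] := boolP (t \in _).
  by rewrite big1// => i _; rewrite indicE mem_set//; exact: tB.
have [i tBi] : exists i, ~ B i (Z i t).
  apply: contrapT => nB; move/negP: tB; apply; apply/mem_set => i _.
  by apply: contrapT => tBi; apply: nB; exists i.
by rewrite (bigD1 i)//= indicE memNset// mul0r.
Qed.

Lemma product_law_preimage (i : 'I_k) (B : set T') :
  measurable B -> P (Z i @^-1` B) = Q B.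
Proof.
move=> mB; pose C j := if j == i then B else setT.
have mC j : measurable (C j) by rewrite /C; case: ifP.
have := product_law_bigcap mC; rewrite (bigD1 i)//= big1 => [|j /negbTE ji].
  rewrite /C eqxx mule1 => <-; congr (P _).
  apply/seteqP; split => [t tB j _|t /(_ i Logic.I)]; last by rewrite eqxx.
  by case: ifPn => // /eqP ->.
by rewrite /C ji probability_setT.
Qed.

End product_law.

(** The space is a product of one that carries fair bits and one that carries the noise, which makes
    input and noise independent. The bits enter as [(-1) ^+ b], so the input entries are 1 or -1 at
    every point and not just almost surely. *)
Lemma exists_channel d0 (T0 : measurableType d0) (R : realType)
    (P0 : probability T0 R) (N1 : {RV P0 >-> R}) (m n : nat) :
  exists (d : measure_display) (T : measurableType d) (P : probability T R)
    (X : 'I_n -> {RV P >-> R}) (N : 'I_m -> {RV P >-> R}),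
  [/\ (forall j t, X j t = 1 \/ X j t = -1),
      mutually_independent X,
      (forall j, P (X j @^-1` [set 1]) = (2^-1)%:E /\
                 P (X j @^-1` [set -1]) = (2^-1)%:E),
      product_law (distribution P0 N1) N &
      independent2 (tupleRV X : {RV P >-> n.-tuple R})
                   (tupleRV N : {RV P >-> m.-tuple R})].
Proof.
have [dN [TN [PN [N QN]]]] := exists_product_law (distribution P0 N1) m.
have [dX [TX [PX [X QX]]]] := exists_product_law (bernoulli_prob (2^-1 : R)) n.
have half01 : 0 <= (2^-1 : R) <= 1 by apply/andP; split; lra.
have ms : measurable_fun [set: bool] (fun b : bool => (-1) ^+ b : R) by [].
have mXX j : measurable_fun [set: TX] (fun t => (-1) ^+ (X j t) : R).
  exact: (measurableT_comp ms).
pose XX j := mkRV PX (mXX j).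
have mX j : measurable_fun [set: TX * TN] (fun t => XX j t.1).
  exact: measurableT_comp measurable_fst.
have mN i : measurable_fun [set: TX * TN] (fun t => N i t.2).
  exact: measurableT_comp measurable_snd.
have PfstE (A : set TX) : measurable A -> (PX \x PN)%E (fst @^-1` A) = PX A.
  move=> mA; rewrite (_ : fst @^-1` A = A `*` setT); last first.
    by apply/seteqP; split => [[x y]//|[x y] []].
  rewrite product_measure1E// -[RHS]mule1; congr (_ * _)%E.
  exact: probability_setT.
have PsndE (A : set TN) : measurable A -> (PX \x PN)%E (snd @^-1` A) = PN A.
  move=> mA; rewrite (_ : snd @^-1` A = setT `*` A); last first.
    by apply/seteqP; split => [[x y]//|[x y] []].
  rewrite product_measure1E// -[RHS]mul1e; congr (_ * _)%E.
  exact: probability_setT.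
have mpre d1 d2 (T1 : measurableType d1) (T2 : measurableType d2)
    (P : probability T1 R) (Z : {RV P >-> T2}) (A : set T2) :
    measurable A -> measurable (Z @^-1` A).
  by move=> mA; rewrite -[X in measurable X]setTI; exact: measurable_funPT.
exists _, _, (PX \x PN)%E, (fun j => mkRV _ (mX j)), (fun i => mkRV _ (mN i)).
split.
- by move=> j t /=; case: (X j t.1); rewrite ?expr1; [right|left].
- move=> B mB.
  pose C j := (fun b : bool => (-1) ^+ b : R) @^-1` B j.
  have mC j : measurable (C j) by rewrite -[X in measurable X]setTI; exact: ms.
  transitivity ((PX \x PN)%E
      (fst @^-1` (\bigcap_(j in [set: 'I_n]) (X j @^-1` C j)))).
    by congr (_ _); apply/seteqP; split.
  rewrite PfstE; last first.
    by apply: fin_bigcap_measurable => [|j _];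
      [exact: finite_finset|exact: mpre].
  rewrite (product_law_bigcap QX)//; apply: eq_bigr => j _.
  rewrite -(product_law_preimage QX j)// -PfstE//; exact: mpre.
- have bern1 b : bernoulli_prob (2^-1 : R) [set b] = (2^-1)%:E.
    rewrite /bernoulli_prob half01 fsbig_set1 /bernoulli_pmf; case: b => //.
    by congr _%:E; lra.
  have PXj j (b : bool) :
      (PX \x PN)%E (fst @^-1` (XX j @^-1` [set (-1) ^+ b])) = (2^-1)%:E.
    rewrite PfstE; last exact: mpre.
    rewrite -(bern1 b) -(product_law_preimage QX j)//; congr (PX _).
    apply/seteqP; split => t /= => [|-> //].
    by move=> /eqP; rewrite -subr_eq0; case: (X j t) b => [] [] //=;
      rewrite ?expr1 => /eqP ?; exfalso; lra.
  by move=> j; split; [exact: (PXj j false)|exact: (PXj j true)].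
- move=> h mh h0.
  have mprod : measurable_fun setT (fun t => \prod_(i < m) h i (N i t))%E.
    by apply: measurable_prode => i; exact: measurableT_comp.
  have prod0 t : (0 <= \prod_(i < m) h i (N i t))%E by exact: prode_ge0.
  rewrite (@fubini_tonelli1 _ _ _ _ _ _ _
    (fun t : TX * TN => \prod_(i < m) h i (N i t.2))%E)//; last first.
    exact: (measurableT_comp mprod measurable_snd).
  rewrite /fubini_F /= (eq_integral (cst
    (\prod_(i < m) \int[distribution P0 N1]_x h i x)%E)); last first.
    by move=> x _; rewrite QN.
  by rewrite integral_cst// [X in (_ * X)%E]probability_setT mule1.
- move=> A B mA mB.
  transitivity ((PX \x PN)%E ((tupleRV XX @^-1` A) `*` (tupleRV N @^-1` B))).
    by congr (_ _); apply/seteqP; split => [[x y]|[x y]] [].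
  rewrite product_measure1E; try exact: mpre.
  by congr (_ * _)%E; apply/esym; [apply: PfstE|apply: PsndE]; exact: mpre.
Qed.

(** * The channel *)

Lemma powR_opp_sum (R : realType) (I : Type) (s : seq I) (f : I -> R) :
  2 `^ (- \sum_(i <- s) f i) = \prod_(i <- s) 2 `^ (- f i) :> R.
Proof.
elim: s => [|i s ih]; first by rewrite !big_nil oppr0 powRr0.
by rewrite !big_cons opprD powRD ?ih// pnatr_eq0 implybT.
Qed.

Lemma cdma_outputE d (T : measurableType d) (R : realType) (P : probability T R)
    (m n : nat) (A : 'M[R]_(m, n)) (X : 'I_n -> {RV P >-> R})
    (N : 'I_m -> {RV P >-> R}) i t :
  cdma_output A X N i t = (Num.sqrt m%:R)^-1 * (\sum_j A i j * X j t) + N i t.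
Proof.
rewrite /cdma_output !mxE; congr (_ * _ + _).
by apply: eq_bigr => j _; rewrite mxE.
Qed.

(** * Exponential means of the translated noise *)

Section translates.
Context d (T : measurableType d) (R : realType) (P : probability T R)
  (N1 : {RV P >-> R}) (q : R -> R).
Hypothesis q_meas : measurable_fun [set: R] q.
Variable c : R.

(** The integral is against the law of [N1], so that it can be used on any space that carries copies
    of [N1]. *)
Definition translate_mean (v : R) : \bar R :=
  (\int[distribution P N1]_x (2 `^ (- q (x + c * v)))%:E)%E.

Lemma measurable_pow2_opp d' (T' : measurableType d') (f : T' -> R) :
  measurable_fun [set: T'] f ->
  measurable_fun [set: T'] (fun x => (2 `^ (- q (f x)))%:E).
Proof.
move=> mf; apply/measurable_EFinP;
  apply: (measurableT_comp (measurable_powRr 2)).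
by apply: measurableT_comp => //; exact: measurableT_comp mf.
Qed.

Let mpair : measurable_fun [set: R * R]
  (fun z => (2 `^ (- q (z.2 + c * z.1)))%:E).
Proof.
apply: measurable_pow2_opp; apply: measurable_funD; first exact: measurable_snd.
by apply: measurable_funM => //; exact: measurable_fst.
Qed.

Lemma translate_mean_ge0 v : (0 <= translate_mean v)%E.
Proof. by apply: integral_ge0 => x _; rewrite lee_fin powR_ge0. Qed.

Lemma measurable_translate_mean : measurable_fun [set: R] translate_mean.
Proof.
apply: (@measurable_fun_fubini_tonelli_F _ _ _ _ _ (distribution P N1)
  (fun z => (2 `^ (- q (z.2 + c * z.1)))%:E)) => //.
Qed.

Lemma translate_meanE v :
  translate_mean v = (\int[P]_t (2 `^ (- q (N1 t + c * v)))%:E)%E.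
Proof.
rewrite /translate_mean ge0_integral_distribution//.
- by apply: measurable_pow2_opp; exact: measurable_funD.
Qed.

(** By independence the noise is integrated out first with [S] fixed, which leaves a function of the
    signs alone. *)
Lemma rademacher_translate_mean (k : nat) (S : {RV P >-> R}) :
  is_rademacher_sum k S -> independent2 S N1 ->
  (\int[P]_t (2 `^ (- q (N1 t + c * (- 2 * S t))))%:E =
  \sum_(u : {set 'I_k}) ((2 ^+ k)^-1)%:E *
     translate_mean (- 2 * \sum_i sgn R u i)%R)%E.
Proof.
move=> [eps [ieps half Seps]] SN.
pose G (z : R * R) := (2 `^ (- q (z.2 + c * (- 2 * z.1))))%:E.
rewrite [LHS](@ge0_integral_independent2 _ _ _ _ _ _ _ _ S N1 G SN);
  last 2 first.
- apply: measurable_pow2_opp; apply: measurable_funD;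
    first exact: measurable_snd.
  by do 2 apply: measurable_funM => //; exact: measurable_fst.
- by move=> z; rewrite lee_fin powR_ge0.
rewrite (eq_integral (fun t => (translate_mean \o
    (fun x : k.-tuple R => - 2 * \sum_i tnth x i)) (tupleRV eps t)));
      last first.
  move=> t _ /=; have -> : \sum_i tnth (tupleRV eps t) i = S t.
    by rewrite Seps; apply: eq_bigr => i _; rewrite tnth_mktuple.
  by rewrite translate_meanE.
rewrite ge0_integral_signs//.
- apply: eq_bigr => u _ /=; congr (_ * translate_mean (_ * _))%E.
  by apply: eq_bigr => i _; rewrite tnth_mktuple.
- apply: (measurableT_comp measurable_translate_mean).
  apply: measurable_funM => //; apply: measurable_sum => i.
  exact: measurable_tnth.
- by move=> x; exact: translate_mean_ge0.
Qed.

End translates.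

(** * The test function for coupled and decoupled input and output *)

Section channel.
Context d0 (T0 : measurableType d0) (R : realType) (P0 : probability T0 R)
  (N1 : {RV P0 >-> R}) (q : R -> R).
Hypothesis q_meas : measurable_fun [set: R] q.
Context d (T : measurableType d) (P : probability T R) (m n : nat)
  (X : 'I_n -> {RV P >-> R}) (N : 'I_m -> {RV P >-> R}) (A : 'M[R]_(m, n)).
Hypothesis X_indep : mutually_independent X.
Hypothesis X_half : forall j, P (X j @^-1` [set 1]) = (2^-1)%:E /\
                              P (X j @^-1` [set -1]) = (2^-1)%:E.
Hypothesis N_law : product_law (distribution P0 N1) N.
Hypothesis XN_indep : independent2 (tupleRV X : {RV P >-> n.-tuple R})
                                   (tupleRV N : {RV P >-> m.-tuple R}).

Let c : R := (Num.sqrt m%:R)^-1.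
Let psi := translate_mean N1 q c.
Let Y : {RV P >-> m.-tuple R} :=
  tupleRV (fun i => cdma_output A X N i : {RV P >-> R}).

(** The argument of [q] is the residual of the output once the signal of the candidate input is
    subtracted; for the true input it is the noise. *)
Definition score (z : n.-tuple R * m.-tuple R) : R :=
  - \sum_(i < m) q (tnth z.2 i - c * \sum_j A i j * tnth z.1 j).

Lemma measurable_score : measurable_fun [set: n.-tuple R * m.-tuple R] score.
Proof.
apply: measurableT_comp => //; apply: measurable_sum => i.
apply: (measurableT_comp q_meas); apply: measurable_funB.
  exact: (measurableT_comp (measurable_tnth i) measurable_snd).
apply: measurable_funM => //; apply: measurable_sum => j.
apply: measurable_funM => //.
exact: (measurableT_comp (measurable_tnth j) measurable_fst).
Qed.

Lemma score_output t : score (tupleRV X t, Y t) = - \sum_(i < m) q (N i t).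
Proof.
rewrite /score; congr (- _); apply: eq_bigr => i _; congr q.
rewrite /Y tnth_mktuple /= cdma_outputE -/c /=.
rewrite [in X in _ - X](eq_bigr (fun j => A i j * X j t)) => [|j _].
  by rewrite addrAC subrr add0r.
by rewrite tnth_mktuple.
Qed.

(** If the output comes from an input [x'], its residual against [x] is [N_i + c (A (x' - x))_i].
    Integrating the noise gives one factor [psi] per row; [s'] and [s] then run over the values of
    [x'] and [x]. *)
Lemma decoupled_mean :
  (\int[distribution P (tupleRV X : {RV P >-> n.-tuple R})
        \x distribution P Y]_z
     (2 `^ score z)%:E =
   \sum_(s : {set 'I_n}) ((2 ^+ n)^-1)%:E *
     \sum_(s' : {set 'I_n}) ((2 ^+ n)^-1)%:E *
       \prod_(i < m) psi (\sum_j A i j * (sgn R s' j - sgn R s j))%R)%E.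
Proof.
have m2score : measurable_fun [set: n.-tuple R * m.-tuple R]
    (fun z => (2 `^ score z)%:E).
  apply/measurable_EFinP.
  exact: (measurableT_comp (measurable_powRr 2) measurable_score).
rewrite ge0_integral_product_distribution//.
pose V i (x x' : n.-tuple R) := \sum_j A i j * (tnth x' j - tnth x j).
pose Phi x x' : \bar R := (\prod_(i < m) psi (V i x x'))%E.
have mV i x : measurable_fun [set: n.-tuple R] (V i x).
  apply: measurable_sum => j; apply: measurable_funM => //.
  by apply: measurable_funB => //; exact: measurable_tnth.
have mV' i x' : measurable_fun [set: n.-tuple R] (V i ^~ x').
  apply: measurable_sum => j; apply: measurable_funM => //.
  by apply: measurable_funB => //; exact: measurable_tnth.
have mPhi x : measurable_fun [set: n.-tuple R] (Phi x).
  apply: measurable_prode => i.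
  exact: (measurableT_comp (measurable_translate_mean N1 q_meas c)).
have mPhi' x' : measurable_fun [set: n.-tuple R] (Phi ^~ x').
  apply: measurable_prode => i.
  exact: (measurableT_comp (measurable_translate_mean N1 q_meas c)).
have Phi0 x x' : (0 <= Phi x x')%E.
  by apply: prode_ge0 => i _; exact: translate_mean_ge0.
have inner x : (\int[P]_t (2 `^ score (x, Y t))%:E =
    \sum_(s' : {set 'I_n}) ((2 ^+ n)^-1)%:E *
      Phi x [tuple sgn R s' j | j < n])%E.
  (* [G] expresses [2^score] through the input and the noise behind the output, so that their
     independence applies. *)
  pose G (z : n.-tuple R * m.-tuple R) : \bar R :=
    (\prod_(i < m) (2 `^ (- q (tnth z.2 i + c * V i x z.1)))%:E)%E.
  have mG : measurable_fun [set: n.-tuple R * m.-tuple R] G.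
    apply: measurable_prode => i; apply: measurable_pow2_opp => //.
    apply: measurable_funD.
      exact: (measurableT_comp (measurable_tnth i) measurable_snd).
    apply: measurable_funM => //.
    exact: (measurableT_comp (mV i x) measurable_fst).
  have G0 z : (0 <= G z)%E by apply: prode_ge0 => i _; rewrite lee_fin powR_ge0.
  transitivity (\int[P]_t G (tupleRV X t, tupleRV N t))%E.
    apply: eq_integral => t _; rewrite /score /G /= powR_opp_sum -prodEFin.
    apply: eq_bigr => i _; congr (2 `^ (- q _))%:E.
    rewrite /V !tnth_mktuple /= cdma_outputE -/c [c * _ + _]addrC -addrA.
    rewrite -mulrBr -sumrB.
    congr (_ + _ * _); apply: eq_bigr => j _; by rewrite tnth_mktuple mulrBr.
  rewrite (ge0_integral_independent2 XN_indep mG G0).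
  rewrite (eq_integral (fun t => Phi x (tupleRV X t))); last first.
    move=> t _; rewrite /Phi -(N_law (h := fun i y =>
      (2 `^ (- q (y + c * V i x (tupleRV X t))))%:E)).
    - by apply: eq_integral => t' _; apply: eq_bigr => i _;
        rewrite tnth_mktuple.
    - by move=> i; apply: measurable_pow2_opp => //; exact: measurable_funD.
    - by move=> i y; rewrite lee_fin powR_ge0.
  exact: ge0_integral_signs.
pose H x := (\sum_(s' : {set 'I_n}) ((2 ^+ n)^-1)%:E *
  Phi x [tuple sgn R s' j | j < n])%E.
rewrite (eq_integral (fun t => H (tupleRV X t))); last first.
  by move=> t _; rewrite inner.
have w0 : (0 <= ((2 ^+ n)^-1 : R)%:E)%E by rewrite lee_fin invr_ge0 exprn_ge0.
rewrite (@ge0_integral_signs _ _ _ _ _ X H)//.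
- apply: eq_bigr => s _; congr (_ * _)%E; apply: eq_bigr => s' _;
    congr (_ * _)%E.
  apply: eq_bigr => i _; congr psi; apply: eq_bigr => j _.
  by rewrite !tnth_mktuple.
- by apply: emeasurable_sum => s'; exact: emeasurable_funM.
- by move=> x; apply: sume_ge0 => s' _; rewrite mule_ge0.
Qed.

End channel.

(** * Finiteness of means and transfer between spaces *)

Lemma log2e_pinfty (R : realType) : log2e (+oo%E : \bar R) = +oo%E.
Proof. by rewrite /log2e /= gt0_mulye// lte_fin invr_gt0 ln2_gt0. Qed.

Lemma fin_num_mulel (R : realType) (r : R) (x : \bar R) :
  0 < r -> (0 <= x)%E -> (r%:E * x)%E \is a fin_num -> x \is a fin_num.
Proof. by move=> r0; case: x => // _; rewrite gt0_muley. Qed.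

Lemma fin_num_expe (R : realType) (x : \bar R) (m : nat) : (0 < m)%N ->
  (0 <= x)%E -> (x ^+ m)%E \is a fin_num -> x \is a fin_num.
Proof.
case: m => // m _; case: x => // _.
by rewrite expeS gt0_mulye// expe_gt0.
Qed.

(** This is [1 + y <= exp y] at [y = x ln 2], weakened by dropping the 1. *)
Lemma ge_opp_pow2 (R : realType) (x : R) : x <= (ln 2)^-1 * 2 `^ x.
Proof.
rewrite mulrC ler_pdivlMr ?ln2_gt0// /powR pnatr_eq0 /=.
by have := expR_ge1Dx (x * ln 2); lra.
Qed.

(** The negative part of [f] is at most [2^(-f) / ln 2]. *)
Lemma integral_funeneg_pow2_lty d (T : measurableType d) (R : realType)
    (P : probability T R) (f : T -> R) :
  measurable_fun [set: T] f ->
  (\int[P]_t (2 `^ (- f t))%:E)%E \is a fin_num ->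
  (\int[P]_t ((EFin \o f)^\- t) < +oo)%E.
Proof.
move=> mf fin.
have m2 : measurable_fun [set: T] (fun t => (2 `^ (- f t))%:E).
  apply/measurable_EFinP; apply: (measurableT_comp (measurable_powRr 2)).
  exact: measurableT_comp.
apply: (@le_lt_trans _ _ (\int[P]_t ((ln 2)^-1%:E * (2 `^ (- f t))%:E))%E).
  apply: ge0_le_integral => //.
  - by apply: measurable_funeneg; exact/measurable_EFinP.
  - exact: emeasurable_funM.
  - move=> t _; rewrite funenegE /= -EFinM ge_max !lee_fin ge_opp_pow2 /=.
    by rewrite mulr_ge0 ?invr_ge0 ?powR_ge0// ltW// ln2_gt0.
rewrite ge0_integralZl//; last first.
  by rewrite lee_fin invr_ge0 ltW// ln2_gt0.
by rewrite -(fineK fin) -EFinM ltry.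
Qed.

(** This carries the mean of [q (N1)] from the given space over to the noise of the constructed
    channel. *)
Lemma integral_same_law d1 d2 (T1 : measurableType d1) (T2 : measurableType d2)
    (R : realType) (P1 : probability T1 R) (P2 : probability T2 R)
    (Z1 : {RV P1 >-> R}) (Z2 : {RV P2 >-> R}) (q : R -> R) :
  measurable_fun [set: R] q ->
  (forall B, measurable B -> P1 (Z1 @^-1` B) = P2 (Z2 @^-1` B)) ->
  P1.-integrable [set: T1] (EFin \o (q \o Z1)) ->
  P2.-integrable [set: T2] (EFin \o (q \o Z2)) /\
  (\int[P2]_t (q (Z2 t))%:E = \int[P1]_t (q (Z1 t))%:E)%E.
Proof.
move=> mq Z12 i1.
have mEq : measurable_fun [set: R] (EFin \o q) by exact/measurable_EFinP.
have law (f : R -> \bar R) :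
    (\int[distribution P2 Z2]_x f x = \int[distribution P1 Z1]_x f x)%E.
  by apply: eq_measure_integral => B mB _; exact/esym/Z12.
have i2 : P2.-integrable [set: T2] (EFin \o (q \o Z2)).
  apply/integrableP; split; first by apply/measurable_EFinP;
    exact: measurableT_comp.
  move: i1 => /integrableP[_]; apply: le_lt_trans.
  have mabs : measurable_fun [set: R] (abse \o (EFin \o q)).
    by exact: measurableT_comp.
  have abs0 x : (0 <= (abse \o (EFin \o q)) x)%E by exact: abse_ge0.
  rewrite -[leLHS](@ge0_integral_distribution _ _ _ _ _ P2 Z2
    (abse \o (EFin \o q)))//.
  by rewrite law ge0_integral_distribution.
split=> //.
rewrite -[LHS](@integral_distribution _ _ _ _ _ P2 Z2 (EFin \o q))//.
by rewrite law integral_distribution.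
Qed.

(** * The lower bound on the sum capacity *)

Theorem theorem2 (R : realType) (m n : nat) (m_gt0 : (0 < m)%N)
    (n_gt0 : (0 < n)%N) (f : R -> R) (f_pdf : is_pdf f)
    (d : measure_display) (T : measurableType d) (P : probability T R)
    (N1 : {RV P >-> R}) (N1_density : has_density N1 f)
    (S : nat -> {RV P >-> R})
    (S_sum : forall k : nat, is_rademacher_sum k (S k))
    (S_indep : forall k : nat, independent2 (S k) N1)
    (q : R -> R) (q_meas : measurable_fun [set: R] q) :
  (n%:R%:E - m%:R%:E * 'E_P[fun t => q (N1 t)]
   - log2e (\sum_(0 <= k < n.+1)
       'C(n, k)%:R%:E *
       'E_P[fun t => (2 `^ (- q (N1 t - 2 * S k t / Num.sqrt m%:R)))%R] ^+ m)
   <= sum_capacity m n f)%E.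
Proof.
pose c : R := (Num.sqrt m%:R)^-1; pose psi := translate_mean N1 q c.
pose M k := (\sum_(u : {set 'I_k}) ((2 ^+ k)^-1)%:E *
  psi (- 2 * \sum_i sgn R u i)%R)%E.
have ME k :
    ('E_P[fun t => (2 `^ (- q (N1 t - 2 * S k t / Num.sqrt m%:R)))%R] = M k)%E.
  rewrite unlock /M -(rademacher_translate_mean q_meas c (S_sum k) (S_indep k)).
  apply: eq_integral => t _; congr (2 `^ (- q (_ + _)))%:E.
  by rewrite -/c; ring.
under eq_bigr do rewrite ME.
have w_gt0 k : 0 < (2 ^+ k)^-1 :> R by rewrite invr_gt0 exprn_gt0.
have psi0 v : (0 <= psi v)%E by exact: translate_mean_ge0.
have M0 k : (0 <= M k)%E.
  by apply: sume_ge0 => u _; rewrite mule_ge0// lee_fin ltW.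
have terms0 k : (0 <= 'C(n, k)%:R%:E * M k ^+ m)%E.
  by rewrite mule_ge0// expe_ge0.
set sg := (\sum_(0 <= k < n.+1) _)%E.
(* If the sum is +oo, the left-hand side is -oo whatever the mean of [q] is, because -oo absorbs
   every summand. *)
have [->|sgoo] := eqVneq sg +oo%E; first by rewrite log2e_pinfty addeNy leNye.
have sgfin : sg \is a fin_num.
  by rewrite ge0_fin_numE ?ltey//; exact: sume_ge0.
(* A finite sum has finite terms; the binomial coefficient is positive and [0 < m], so an infinite
   [M k] would make its term infinite. *)
have Mfin k : (k <= n)%N -> M k \is a fin_num.
  move=> kn; have /sum_fin_numP := sgfin.
  move=> /(_ k); rewrite mem_index_iota ltnS kn => /(_ isT isT).
  move=> /fin_num_mulel kfin; apply: (fin_num_expe m_gt0) => //; apply: kfin.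
    by rewrite ltr0n bin_gt0.
  exact: expe_ge0.
have psifin k (u : {set 'I_k}) : (k <= n)%N ->
    psi (- 2 * \sum_i sgn R u i) \is a fin_num.
  move=> /Mfin /sum_fin_numP /(_ u (mem_index_enum _) isT).
  exact: fin_num_mulel.
have mf : measurable_fun [set: T] (q \o N1) by exact: measurableT_comp.
have fneg : (\int[P]_t ((EFin \o (q \o N1))^\- t) < +oo)%E.
  apply: integral_funeneg_pow2_lty => //.
  (* The term [k = 0] has an empty sign sum, so it is [psi 0], the mean of [2^(-q(N1))]. *)
  have := psifin 0%N finset.set0 (leq0n _); rewrite big_ord0 mulr0.
  rewrite /psi translate_meanE//.
  by under eq_integral do rewrite mulr0 addr0.
set Eq := ('E_P[_])%E.
have EqE : Eq = (\int[P]_t (EFin \o (q \o N1)) t)%E by rewrite /Eq unlock.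
have fneg0 : (0 <= \int[P]_t ((EFin \o (q \o N1))^\- t))%E.
  by exact: integral_ge0.
have fnegfin : (\int[P]_t ((EFin \o (q \o N1))^\- t))%E \is a fin_num.
  by rewrite ge0_fin_numE.
(* An infinite positive part makes [Eq = +oo], and [0 < m] sends the left-hand side to -oo. *)
have [fpos|fpos] := eqVneq (\int[P]_t ((EFin \o (q \o N1))^\+ t))%E +oo%E.
  rewrite EqE integralE fpos -(fineK fnegfin) -EFinN addye//.
  rewrite gt0_muley ?lte_fin ?ltr0n//.
  by rewrite addeNy addNye leNye.
have iq : P.-integrable [set: T] (EFin \o (q \o N1)).
  apply/integrableP; split; first exact/measurable_EFinP.
  under eq_integral do rewrite -/((abse \o (EFin \o (q \o N1))) _) fune_abse.
  rewrite ge0_integralD//.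
  - by rewrite lte_add_pinfty// ltey.
  - by apply: measurable_funepos; exact/measurable_EFinP.
  - by apply: measurable_funeneg; exact/measurable_EFinP.
have Eqfin : Eq \is a fin_num by rewrite EqE; exact: integrable_fin_num.
(* By [sum_sgn_diff], the sum of these values over [r] is a multiple of a sum of values already
   known to be finite, so each of them is finite. *)
have psiVfin (s s' r : {set 'I_n}) :
    psi (\sum_j sgn R r j * (sgn R s' j - sgn R s j)) \is a fin_num.
  have := symdiffK s s'; set u := symdiff s' s => uE.
  have : (\sum_(r : {set 'I_n})
      psi (\sum_j sgn R r j * (sgn R (symdiff u s) j - sgn R s j)))
      \is a fin_num.
    rewrite (sum_sgn_diff s u psi).
    have sumfin : \sum_(w : {set 'I_#|u|}) psi (- 2 * \sum_i sgn R w i)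
        \is a fin_num.
      apply/sum_fin_numP => w _ _; apply: psifin.
      by rewrite -[leqRHS]card_ord max_card.
    elim: (2 ^ _)%N => [|l ih]; first by rewrite mulr0n.
    by rewrite mulrS fin_numD sumfin.
  by rewrite uE => /sum_fin_numP /(_ r (mem_index_enum _) isT).
(* [fine] would replace an infinite value by 0, but every value of [psi] that enters the sums below
   is finite. *)
pose psir v := fine (psi v).
pose Mr k := (2 ^+ k)^-1 * \sum_(u : {set 'I_k}) psir (- 2 * \sum_i sgn R u i).
have MrE k : (k <= n)%N -> M k = (Mr k)%:E.
  move=> kn; rewrite /Mr mulr_sumr -sumEFin; apply: eq_bigr => u _.
  by rewrite EFinM fineK// psifin.
pose sr := \sum_(k < n.+1) 'C(n, k)%:R * Mr k ^+ m.
have sgE : sg = sr%:E.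
  rewrite /sg big_mkord -sumEFin; apply: eq_bigr => k _.
  by rewrite MrE -?EFin_expe// -ltnS.
have [B HB] := exists_sign_matrix m n psir; rewrite -/sr in HB.
pose A : 'M[R]_(m, n) := \matrix_(i, j) sgn R (B i) j.
have [d' [T' [P' [X [N [Xpm Xindep Xhalf Nlaw XN]]]]]] := exists_channel N1 m n.
pose tX : {RV P' >-> n.-tuple R} := tupleRV X.
pose Y : {RV P' >-> m.-tuple R} :=
  tupleRV (fun i => cdma_output A X N i : {RV P' >-> R}).
pose nu : probability _ R := (distribution P' tX \x distribution P' Y)%E.
pose mu : probability _ R := distribution P' (pairRV tX Y).
pose z := (2 ^+ n * 2 ^+ n)^-1 * (\sum_(s : {set 'I_n}) \sum_(s' : {set 'I_n})
   \prod_(i < m) psir (\sum_j sgn R (B i) j * (sgn R s' j - sgn R s j))).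
(* For the matrix [A] read off from [B], the quantity bounded in [HB] is the decoupled mean of
   [2^score]. *)
have zE : (\int[nu]_z (2 `^ score q A z)%:E = z%:E)%E.
  rewrite [LHS](decoupled_mean q_meas A Xindep Xhalf Nlaw XN).
  rewrite /z invfM mulr_sumr -sumEFin; apply: eq_bigr => s _.
  rewrite -mulrA mulr_sumr EFinM; congr (_ * _)%E.
  rewrite -sumEFin; apply: eq_bigr => s' _; rewrite EFinM; congr (_ * _)%E.
  rewrite -prodEFin; apply: eq_bigr => i _.
  rewrite (eq_bigr (fun j => sgn R (B i) j * (sgn R s' j - sgn R s j)));
    last first.
    by move=> j _; rewrite mxE.
  by rewrite fineK.
have mscore : measurable_fun setT (score q A) := measurable_score q_meas A.
have z_gt0 : 0 < z.
  rewrite -lte_fin -zE; apply: integral_gt0 => [|x]; last exact: powR_gt0.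
  exact: (measurableT_comp (measurable_powRr 2)).
have Nsame i B' : measurable B' -> P (N1 @^-1` B') = P' (N i @^-1` B').
  by move=> mB; rewrite (product_law_preimage Nlaw).
have iN i : P'.-integrable [set: T'] (EFin \o (q \o N i)).
  by have [] := integral_same_law q_meas (Nsame i) iq.
have EN i : (\int[P']_t (q (N i t))%:E = Eq)%E.
  by have [_ ->] := integral_same_law q_meas (Nsame i) iq; rewrite EqE.
have scoreE t : (score q A (tX t, Y t))%:E = (- \sum_(i < m) (q (N i t))%:E)%E.
  by rewrite sumEFin -EFinN -(score_output q X N A).
have iscore' : P'.-integrable [set: T'] (fun t => (score q A (tX t, Y t))%:E).
  under eq_fun do rewrite scoreE.
  by apply: integrableN => //; apply: integrable_sum => // i _; exact: iN.
have iscore : mu.-integrable setT (EFin \o score q A).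
  apply/integrableP; split; first exact/measurable_EFinP.
  move: iscore' => /integrableP[_]; apply: le_lt_trans.
  rewrite -[leRHS](@ge0_integral_distribution _ _ _ _ _ P' (pairRV tX Y)
    (abse \o (EFin \o score q A)))//; last by move=> x; exact: abse_ge0.
  by apply: measurableT_comp => //; exact/measurable_EFinP.
have Iscore : (\int[mu]_z (score q A z)%:E = - (m%:R%:E * Eq))%E.
  rewrite [LHS](@integral_distribution _ _ _ _ _ P'
    (pairRV tX Y) (EFin \o score q A))//; last first.
    exact/measurable_EFinP.
  rewrite (eq_integral _ _ (fun t _ => scoreE t)).
  rewrite integralN; last first.
    apply: integrable_add_def => //.
    by apply: integrable_sum => // i _; exact: iN.
  rewrite integral_sum//; congr (- _)%E.
  rewrite (eq_bigr (fun=> Eq)) => [|i _]; last exact: EN.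
  rewrite -(fineK Eqfin) sumEFin sumr_const card_ord -EFinM.
  by rewrite mulr_natl.
apply: (@le_trans _ _ (relative_entropy mu nu)).
  apply: le_trans (donsker_varadhan mscore iscore _); last first.
    by rewrite [X in (X < _)%E]zE ltry.
  rewrite [X in (_ <= _ - log2e X)%E]zE Iscore sgE.
  (* Positivity comes from [0 < z] and [z <= (2 ^+ n)^-1 * sr]. *)
  have s_gt0 : 0 < sr.
    have : 0 < (2 ^+ n)^-1 * sr by exact: lt_le_trans HB.
    by rewrite pmulr_rgt0.
  rewrite !log2e_EFin// -(fineK Eqfin) -EFinM -!EFinB lee_fin.
  (* The factor [(2 ^+ n)^-1] in [HB] yields the term [n] of the bound after taking logarithms. *)
  have : ln z <= ln sr - ln 2 * n%:R.
    apply: (@le_trans _ _ (ln ((2 ^+ n)^-1 * sr))).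
      by rewrite ler_ln ?posrE// mulr_gt0.
    rewrite lnM ?posrE// lnV ?posrE ?exprn_gt0// lnXn// -mulr_natr.
    lra.
  move=> lnz.
  have : ln z / ln 2 <= (ln sr - ln 2 * n%:R) / ln 2.
    by rewrite ler_pM2r// invr_gt0 ln2_gt0.
  have -> : (ln sr - ln 2 * n%:R) / ln 2 = ln sr / ln 2 - n%:R.
    by field; rewrite gt_eqF// ln2_gt0.
  by lra.
(* The constructed channel is admissible: each [N i] has the law of [N1], hence the density [f], and
   [product_law] gives mutual independence. *)
apply: (@le_trans _ _ (sum_capacity_of A f)).
  apply: ereal_sup_ubound; exists d', T', P', X, N; split => //.
  split => //.
  - by move=> i B' mB'; rewrite -Nsame// N1_density.
  - move=> C mC; rewrite (product_law_bigcap Nlaw)//; apply: eq_bigr => i _.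
    by rewrite -(product_law_preimage Nlaw i).
apply: ereal_sup_ubound; exists A => // i j; rewrite mxE; exact: sgn_pm1.
Qed.
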